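(* Let $\mathcal{P}\subseteq\Delta(\Omega,\mathcal{F})$ be a nonempty set of countably additive probability measures and let $A\in\mathcal{F}$. If $\mathcal{P}(A):=\{P(A):P\in\mathcal{P}\}$ is closed in the Euclidean topology, then there is no experiment $\mathbf{X}$ for which generalized Bayes' updating weakly uniformly constricts $A$. That is, for every random variable $X$ that is measurable for all $P\in\mathcal{P}$, with sample space $\mathbf{X}=\{X=x_i\}_{i\in\mathcal{I}}$, neither of the following holds: (i) $\inf_{i\in\mathcal{I}}\underline{P}(A\mid X=x_i)>\underline{P}(A)$ and $\sup_{i\in\mathcal{I}}\overline{P}(A\mid X=x_i)\le\overline{P}(A)$; (ii) $\inf_{i\in\mathcal{I}}\underline{P}(A\mid X=x_i)\ge\underline{P}(A)$ and $\sup_{i\in\mathcal{I}}\overline{P}(A\mid X=x_i)<\overline{P}(A)$.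
   Context: $\Delta(\Omega,\mathcal{F})$ is the space of countably additive probability measures on a measurable space $(\Omega,\mathcal{F})$. For a set $\mathcal{P}\subseteq\Delta(\Omega,\mathcal{F})$ (not necessarily closed or convex), $\underline{P}(A)=\inf_{P\in\mathcal{P}}P(A)$ and $\overline{P}(A)=\sup_{P\in\mathcal{P}}P(A)$ are the lower and upper probabilities. $X:\Omega\to\mathbb{R}$ is a random variable measurable with respect to every $P\in\mathcal{P}$, $\mathcal{I}$ is an arbitrary index set, and $\mathbf{X}=\{X=x_i\}_{i\in\mathcal{I}}$ is the sample space of measurable events associated with $X$. Generalized Bayes' updating replaces the bounds by $\underline{P}(A\mid X=x_i)=\inf_{P\in\mathcal{P}}P(A\mid X=x_i)$ and $\overline{P}(A\mid X=x_i)=\sup_{P\in\mathcal{P}}P(A\mid X=x_i)$. To avoid issues with conditioning on null events, it is assumed that the $P$'s in $\mathcal{P}$ agree on those outcomes $\{X=x_i\}$ that are $P$-null. Strict uniform constriction of $A$ means $\inf_i\underline{P}(A\mid X=x_i)>\underline{P}(A)$ and $\sup_i\overline{P}(A\mid X=x_i)<\overline{P}(A)$; weak uniform constriction means that one of these two inequalities is allowed to be weak (so strict implies weak). *)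

(* Defs.v *)
(* MathComp-Analysis *)
From HB Require Import structures.
From mathcomp Require Import all_boot all_order all_algebra.
From mathcomp Require Import all_classical all_reals all_analysis.

Set Implicit Arguments.
Unset Strict Implicit.
Unset Printing Implicit Defensive.

Import Order.TTheory GRing.Theory Num.Theory.
Import numFieldNormedType.Exports.

Local Open Scope classical_set_scope.
Local Open Scope ring_scope.
Local Open Scope ereal_scope.

Section Constriction.
Context (d : measure_display) (T : measurableType d) (R : realType).
Implicit Types (PP : set (probability T R)) (P : probability T R)
  (X : {mfun T >-> R}) (A : set T).

Definition lower_prob PP A : \bar R := ereal_inf [set P A | P in PP].

Definition upper_prob PP A : \bar R := ereal_sup [set P A | P in PP].

(* [g] is a version of x |-> P(A | X = x), in Kolmogorov's sense. If
   P(X = x) > 0, taking B = {x} forces g x = P(A, X = x) / P(X = x); on a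
   null set of outcomes the value is left free. *)
Definition is_cond_prob P X A (g : R -> R) : Prop :=
  (distribution P X).-integrable [set: R] (EFin \o g) /\
  forall B : set R, measurable B ->
    \int[distribution P X]_(x in B) (g x)%:E = P (A `&` X @^-1` B).

(* In the next two definitions [cp P x] stands for P(A | X = x). *)
Definition lower_cond_prob PP (cp : probability T R -> R -> R) (x : R) :
    \bar R :=
  ereal_inf [set (cp P x)%:E | P in PP].

Definition upper_cond_prob PP (cp : probability T R -> R -> R) (x : R) :
    \bar R :=
  ereal_sup [set (cp P x)%:E | P in PP].

(* The events {X = x_i} exhaust the sample space; an event may be listed
   several times, and impossible outcomes may be listed. *)
Definition sample_space X (I : Type) (x : I -> R) : Prop :=
  forall w : T, exists i : I, X w = x i.

Definition agree_on_null_outcomes PP X (I : Type) (x : I -> R) : Prop :=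
  forall P Q : probability T R, PP P -> PP Q ->
    forall i : I, P (X @^-1` [set x i]) = 0 -> Q (X @^-1` [set x i]) = 0.

Definition weakly_uniformly_constricts PP A
    (cp : probability T R -> R -> R) (I : Type) (x : I -> R) : Prop :=
  (ereal_inf [set lower_cond_prob PP cp (x i) | i in [set: I]]
     > lower_prob PP A /\
   ereal_sup [set upper_cond_prob PP cp (x i) | i in [set: I]]
     <= upper_prob PP A)
  \/
  (ereal_inf [set lower_cond_prob PP cp (x i) | i in [set: I]]
     >= lower_prob PP A /\
   ereal_sup [set upper_cond_prob PP cp (x i) | i in [set: I]]
     < upper_prob PP A).

End Constriction.

(* Main.v *)
Require Import Defs.
From HB Require Import structures.
From mathcomp Require Import all_boot all_order all_algebra.
From mathcomp Require Import all_classical all_reals all_analysis.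
From mathcomp Require Import measurable_realfun.

Set Implicit Arguments.
Unset Strict Implicit.
Unset Printing Implicit Defensive.

Import Order.TTheory GRing.Theory Num.Theory.
Import numFieldNormedType.Exports.

Local Open Scope classical_set_scope.
Local Open Scope ring_scope.

(* A closed P(A) attains its infimum and its supremum. If P0 attains the
   infimum, then P0(A) is the P0-expectation of P0(A | X), so the conditional
   probabilities P0(A | X = x_i) cannot all exceed P0(A) by a fixed margin;
   the supremum is symmetric. *)

(** The whole space has mass 1 and the empty set mass 0. The point obtained serves to rule out an
    infinite lower bound on a real-valued function. *)
Lemma prob_setT_neq0 d (T : measurableType d) (R : realType)
  (P : probability T R) : [set: T] !=set0.
Proof.
apply/set0P/eqP => T0; have := @probability_setT _ _ _ P.
by rewrite T0 measure0 => /esym/eqP; rewrite onee_eq0.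
Qed.

(** Monotonicity of the integral against the constant [c], which integrates to itself because the
    total mass is 1. The bound is an extended real so that an infimum taken in [\bar R] can be used
    for [c] directly. *)
Lemma prob_integral_ge d (T : measurableType d) (R : realType)
    (P : probability T R) (f : T -> R) (c : \bar R) :
    P.-integrable [set: T] (EFin \o f) -> (forall w, (c <= (f w)%:E)%E) ->
  (c <= \int[P]_w (f w)%:E)%E.
Proof.
move=> intf; case: c => [c||] cf; last exact: leNye.
- have -> : c%:E = (\int[P]_w (EFin \o cst c) w)%E.
    rewrite (integral_cst P measurableT c%:E) -[LHS]mule1.
    by congr (_ * _)%E; exact/esym/probability_setT.
  apply: (@le_integral _ _ _ P _ measurableT (EFin \o cst c) (EFin \o f)).
  + exact: finite_measure_integrable_cst.
  + exact: intf.
  + by move=> w _; exact: cf.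
(* For [c] equal to [+oo] the hypothesis is contradictory: at some [w] the real number [f w] would
   have to be infinite. *)
- by have [w _] := prob_setT_neq0 P; have := cf w; rewrite leye_eq.
Qed.

(** Change of variables applied to the nonnegative function [|g|]: its integral under the law of [X]
    is that of [|g \o X|] under [P], so one is finite when the other is. *)
Lemma integrable_comp_distribution d (T : measurableType d) (R : realType)
    (P : probability T R) (X : {mfun T >-> R}) (g : R -> R) :
    (distribution P X).-integrable [set: R] (EFin \o g) ->
  P.-integrable [set: T] (EFin \o (g \o X)).
Proof.
move=> /integrableP[/measurable_EFinP mg intg]; apply/integrableP; split.
  apply/measurable_EFinP; apply: (measurableT_comp mg).
  exact: measurable_funPT.
move: intg.
rewrite (@ge0_integral_distribution _ _ _ _ _ P X (abse \o (EFin \o g))) //.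
- by apply: measurableT_comp => //; exact/measurable_EFinP.
- by move=> y; exact: abse_ge0.
Qed.

Section cond_prob.
Context d (T : measurableType d) (R : realType) (P : probability T R).
Variables (X : {mfun T >-> R}) (A : set T) (g : R -> R).
Hypothesis gP : is_cond_prob P X A g.

(** Kolmogorov's identity with [B] the whole line, pulled back from the law of [X] to [P]. *)
Lemma total_probability : (\int[P]_w (g (X w))%:E)%E = P A.
Proof.
have [intg /(_ _ measurableT)] := gP.
rewrite preimage_setT setIT => <-.
rewrite (@integral_distribution _ _ _ _ _ P X (EFin \o g)) //.
- exact: measurable_int intg.
- exact: integrable_comp_distribution.
Qed.

(** An average is at least any lower bound of its values. The bound is asked only at values taken by
    [X], which are the ones a sample space is known to list. *)
Lemma cond_prob_ge (c : \bar R) :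
  (forall w, (c <= (g (X w))%:E)%E) -> (c <= P A)%E.
Proof.
move=> cg; rewrite -total_probability; apply: prob_integral_ge => //.
by apply: integrable_comp_distribution; case: gP.
Qed.

Lemma cond_prob_le (c : \bar R) :
  (forall w, ((g (X w))%:E <= c)%E) -> (P A <= c)%E.
Proof.
move=> gc; have intg : P.-integrable [set: T] (EFin \o (g \o X)).
  by apply: integrable_comp_distribution; case: gP.
(* Negating both sides turns the upper bound on [g] into a lower bound on [- g]. *)
rewrite -leeN2 -total_probability -integralN; last exact: integrable_add_def.
under eq_integral do rewrite -EFinN.
apply: (@prob_integral_ge _ _ _ _ (fun w => - g (X w))).
  exact: integrableN intg.
by move=> w; rewrite EFinN leeN2.
Qed.

End cond_prob.

(** The set of values is a closed subset of the compact segment from 0 to 1. *)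
Lemma closed_prob_compact d (T : measurableType d) (R : realType)
    (PP : set (probability T R)) (A : set T) (mA : measurable A) :
  closed [set fine (P A) | P in PP] -> compact [set fine (P A) | P in PP].
Proof.
move=> clA; apply: (subclosed_compact clA (@segment_compact _ 0 1)).
move=> _ [P _ <-] /=; rewrite in_itv /= fine_ge0 //=.
by rewrite -lee_fin fineK ?fin_num_measure// probability_le1.
Qed.

(** Extreme value theorem for the identity on the compact nonempty set of values; a measure
    realizing the least value is then picked in [PP]. *)
Lemma lower_prob_attained d (T : measurableType d) (R : realType)
    (PP : set (probability T R)) (A : set T) :
    PP !=set0 -> measurable A -> closed [set fine (P A) | P in PP] ->
  exists2 P, PP P & lower_prob PP A = P A.
Proof.
move=> PP0 mA /(closed_prob_compact mA) cA.
have A0 : [set fine (P A) | P in PP] !=set0.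
  by have [Q PP_Q] := PP0; exists (fine (Q A)), Q.
have [|r] := compact_EVT_min (f := id) A0 cA.
  by apply: continuous_subspaceT => ?; exact: cvg_id.
rewrite inE => -[P PP_P <-] Pmin.
exists P => //; apply/le_anti/andP; split.
  by apply: ereal_inf_lbound; exists P.
apply: le_ereal_inf_tmp => _ [Q PP_Q <-].
rewrite -[leLHS]fineK ?fin_num_measure// -[leRHS]fineK ?fin_num_measure//.
by rewrite lee_fin; apply: Pmin; rewrite inE; exists Q.
Qed.

Lemma upper_prob_attained d (T : measurableType d) (R : realType)
    (PP : set (probability T R)) (A : set T) :
    PP !=set0 -> measurable A -> closed [set fine (P A) | P in PP] ->
  exists2 P, PP P & upper_prob PP A = P A.
Proof.
move=> PP0 mA /(closed_prob_compact mA) cA.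
have A0 : [set fine (P A) | P in PP] !=set0.
  by have [Q PP_Q] := PP0; exists (fine (Q A)), Q.
have [|r] := compact_EVT_max (f := id) A0 cA.
  by apply: continuous_subspaceT => ?; exact: cvg_id.
rewrite inE => -[P PP_P <-] Pmax.
exists P => //; apply/le_anti/andP; split; last first.
  by apply: ereal_sup_ubound; exists P.
apply: ge_ereal_sup => _ [Q PP_Q <-].
rewrite -[leLHS]fineK ?fin_num_measure// -[leRHS]fineK ?fin_num_measure//.
by rewrite lee_fin; apply: Pmax; rewrite inE; exists Q.
Qed.

Theorem proposition4 (R : realType) (d : measure_display)
    (T : measurableType d) (PP : set (probability T R)) (A : set T)
    (PP_neq0 : PP !=set0) (mA : measurable A)
    (PPA_closed : closed [set fine (P A) | P in PP])
    (X : {mfun T >-> R}) (I : Type) (x : I -> R)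
    (X_x : sample_space X x)
    (X_null : agree_on_null_outcomes PP X x)
    (cp : probability T R -> R -> R)
    (cpP : forall P : probability T R, PP P -> is_cond_prob P X A (cp P)) :
  ~ weakly_uniformly_constricts PP A cp x.
Proof.
(* Each alternative is refuted through its strict inequality, by proving the reverse weak one. *)
move=> [[+ _]|[_ +]]; apply/negP; rewrite -leNgt.
- have [P PP_P ->] := lower_prob_attained PP_neq0 mA PPA_closed.
  (* Every [w] lies in a listed event, so the infimum over [i], and then over [PP], bounds [cp P] at
     [X w] from below. *)
  apply: (cond_prob_ge (cpP P PP_P)) => w; have [i ->] := X_x w.
  apply: (@le_trans _ _ (lower_cond_prob PP cp (x i))).
  + by apply: ereal_inf_lbound; exists i.
  + by apply: ereal_inf_lbound; exists P.
- have [P PP_P ->] := upper_prob_attained PP_neq0 mA PPA_closed.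
  apply: (cond_prob_le (cpP P PP_P)) => w; have [i ->] := X_x w.
  apply: (@le_trans _ _ (upper_cond_prob PP cp (x i))).
  + by apply: ereal_sup_ubound; exists P.
  + by apply: ereal_sup_ubound; exists i.
Qed.
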